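(* Let $B(w)=\sum_{n\ge1}B_n\frac{w^n}{n!}\in\mathbb{C}[[w]]$ with $B_1\ne0$, and let $D_B:\mathbb{C}[x]\to\mathbb{C}[x]$ be the umbral shift attached to $B(w)$, i.e. the unique linear map satisfying $D_{B}e^{xB(w)}=\frac{\partial}{\partial w}e^{xB(w)}$. Then $D_{B}$ and the operator $B^{*}(v) \circ \frac{d}{dv}$ on $\mathbb{C}[[v]]$ are adjoints, i.e. $\langle B^*(v)A'(v)|p(x)\rangle=\langle A(v)|D_B(p(x))\rangle$ for all $A(v)\in\mathbb{C}[[v]]$ and $p(x)\in\mathbb{C}[x]$.
   Context: For $A(v)=\sum_{n\ge0}A_n\frac{v^n}{n!}\in\mathbb{C}[[v]]$ and $f(x)=\sum_{n\ge0}f_nx^n\in\mathbb{C}[x]$, define $\langle A(v)|f(x)\rangle=\sum_{n\ge0}f_nA_n$. $\overline{B}$ denotes the compositional inverse of $B$, and $B^*(v)=B'(\overline{B}(v))$, regarded as a multiplication operator on $\mathbb{C}[[v]]$. Linear operators on $\mathbb{C}[x]$ act on elements of $\mathbb{C}[x][[w]]$ (such as the formal exponential $e^{xB(w)}=\sum_{n\ge0}x^nB(w)^n/n!$) coefficientwise in powers of $w$. *)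

(* Defs.v *)
From HB Require Import structures.
From mathcomp Require Import all_boot all_order all_algebra.
From mathcomp Require Import zify.
From mathcomp Require Export complex.
From mathcomp Require Export reals.

Set Implicit Arguments.
Unset Strict Implicit.
Unset Printing Implicit Defensive.

Import GRing.Theory Num.Theory.
Local Open Scope ring_scope.

(* The power series \sum_n f_n v^n, given by its ordinary coefficients f_n;
   its coefficients in the normalisation \sum_n F_n v^n / n! are
   F_n = egf_coef f n. *)
Definition fps (V : Type) := nat -> V.

Definition fps_deriv (V : nmodType) (f : fps V) : fps V :=
  fun n => f n.+1 *+ n.+1.

Definition egf_coef (K : pzRingType) (f : fps K) (n : nat) : K :=
  n`!%:R * f n.

Section Ring.
Variable K : comNzRingType.
Implicit Types f g : fps K.

Definition fps_one : fps K := fun n => (n == 0)%:R.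

Definition fps_X : fps K := fun n => (n == 1)%:R.

Definition fps_mul f g : fps K :=
  fun n => \sum_(i < n.+1) f i * g (n - i)%N.

Definition fps_pow f n : fps K := iter n (fps_mul f) fps_one.

(* f(g(v)), meaningful only when g 0 = 0: then g^k has no term of degree less
   than k, so that the terms k > n do not contribute to the coefficient of
   v^n. *)
Definition fps_comp f g : fps K :=
  fun n => \sum_(k < n.+1) f k * fps_pow g k n.

Definition is_comp_inverse f g : Prop :=
  [/\ g 0%N = 0, fps_comp f g =1 fps_X & fps_comp g f =1 fps_X].

(* B^*(v) = B'(Bbar(v)), where Bbar is the compositional inverse of B *)
Definition fps_star B Bbar : fps K := fps_comp (fps_deriv B) Bbar.

Definition pairing f (p : {poly K}) : K :=
  \sum_(n < size p) p`_n * egf_coef f n.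

End Ring.

Section Umbral.
Variable K : fieldType.

(* e^{xB(w)} = \sum_n x^n B(w)^n / n! as a series in w over K[x]; the terms
   n > m do not contribute to the coefficient of w^m because B 0 = 0. *)
Definition exp_xB (B : fps K) : fps {poly K} :=
  fun m => \sum_(n < m.+1) (n`!%:R^-1 * fps_pow B n m) *: 'X^n.

Definition is_umbral_shift (B : fps K) (D : {linear {poly K} -> {poly K}}) :=
  (fun m => D (exp_xB B m)) =1 fps_deriv (exp_xB B).

End Umbral.

(* Existence and uniqueness of the compositional inverse and of the umbral
   shift, for B with B 0 = 0 and B 1 != 0. *)

Section CompTheory.
Variable K : comNzRingType.
Implicit Types (f g h : fps K) (p q : {poly K}).

Let agree N f p := forall i, (i < N)%N -> f i = p`_i.

Let agree_trunc N f : agree N f (\poly_(i < N) f i).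
Proof. by move=> i ltiN; rewrite coef_poly ltiN. Qed.

Let agree_mul N f g p q :
  agree N f p -> agree N g q -> agree N (fps_mul f g) (p * q).
Proof.
move=> fp gq i ltiN; rewrite coefM; apply: eq_bigr => j _.
rewrite fp ?gq //; first by apply: leq_ltn_trans ltiN; rewrite leq_subr.
by apply: leq_ltn_trans ltiN; rewrite -ltnS.
Qed.

Let agree_exp N f p n : agree N f p -> agree N (fps_pow f n) (p ^+ n).
Proof.
move=> fp; elim: n => [|n IHn]; first by move=> i _; rewrite expr0 coef1.
by rewrite exprS; apply: agree_mul.
Qed.

Let coef_exp_small p k n : p`_0 = 0 -> (n < k)%N -> (p ^+ k)`_n = 0.
Proof.
move=> p0; elim: k n => // k IHk n; rewrite ltnS => lenk.
rewrite exprS coefM big1 // => -[[|i] /= lti] _; first by rewrite p0 mul0r.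
by rewrite IHk ?mulr0 //; apply: leq_trans lenk; rewrite ltn_subrL /=; case: n lti.
Qed.

Lemma fps_pow_small f k n : f 0%N = 0 -> (n < k)%N -> fps_pow f k n = 0.
Proof.
move=> f0 ltnk; rewrite (agree_exp k (@agree_trunc n.+1 f)) //.
by apply: coef_exp_small => //; rewrite coef_poly.
Qed.

Lemma fps_pow_diag f n : f 0%N = 0 -> fps_pow f n n = f 1%N ^+ n.
Proof.
move=> f0; elim: n => [|n IHn] //; rewrite /fps_pow iterS /fps_mul.
rewrite big_ord_recl f0 mul0r add0r big_ord_recl /= subSS subn0.
rewrite -[iter n _ _]/(fps_pow f n) IHn -exprS.
rewrite big1 ?addr0 // => i _; rewrite fps_pow_small ?mulr0 //.
by rewrite /bump /= !add1n subSS ltn_subrL /= (leq_ltn_trans _ (ltn_ord i)).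
Qed.

Let agree_comp N f g p q : g 0%N = 0 -> (0 < N)%N ->
  agree N f p -> agree N g q -> agree N (fps_comp f g) (p \Po q).
Proof.
move=> g0 N0 fp gq n ltnN; have q0 : q`_0 = 0 by rewrite -gq.
pose F k := p`_k * (q ^+ k)`_n.
have widen M M' : (M <= M')%N -> (forall k, (M <= k)%N -> F k = 0) ->
    \sum_(k < M) F k = \sum_(k < M') F k.
  move=> leMM' F0; rewrite -!(big_mkord xpredT F) (big_cat_nat (n := M) _ leMM') //=.
  by rewrite [X in _ + X]big_nat [X in _ + X]big1 ?addr0 // => k /andP[/F0].
rewrite coef_comp_poly /fps_comp; transitivity (\sum_(k < n.+1) F k).
  apply: eq_bigr => k _; rewrite fp ?(agree_exp k gq) //.
  by apply: leq_ltn_trans ltnN; rewrite -ltnS.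
rewrite (widen _ (maxn n.+1 (size p))) ?leq_maxl //; last first.
  by move=> k ltnk; rewrite /F coef_exp_small ?mulr0.
rewrite -(widen (size p)) ?leq_maxr // => k lek.
by rewrite /F nth_default ?mul0r.
Qed.

Lemma fps_comp0 f g : fps_comp f g 0 = f 0.
Proof. by rewrite /fps_comp big_ord1 mulr1. Qed.

Lemma fps_compA f g h : g 0%N = 0 -> h 0%N = 0 ->
  fps_comp f (fps_comp g h) =1 fps_comp (fps_comp f g) h.
Proof.
move=> g0 h0 n; have gh0 : fps_comp g h 0%N = 0 by rewrite fps_comp0.
have A u := @agree_trunc n.+1 u.
rewrite (agree_comp gh0 _ (A f) (agree_comp h0 _ (A g) (A h))) //.
by rewrite (agree_comp h0 _ (agree_comp g0 _ (A f) (A g)) (A h)) // comp_polyA.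
Qed.

Lemma fps_comp_ext f f' g g' : f =1 f' -> g =1 g' -> fps_comp f g =1 fps_comp f' g'.
Proof.
move=> ef eg n; have eX k m : fps_pow g k m = fps_pow g' k m.
  elim: k m => // k IHk m.
  by apply: eq_bigr => i _; rewrite eg; congr (_ * _); apply: IHk.
by apply: eq_bigr => k _; rewrite ef eX.
Qed.

Let agree_X N : agree N (fps_X K) 'X.
Proof. by move=> i _; rewrite coefX. Qed.

Lemma fps_compX f : fps_comp f (fps_X K) =1 f.
Proof.
move=> n.
rewrite (@agree_comp n.+1 _ _ _ _ erefl _ (@agree_trunc n.+1 f) (@agree_X _)) //.
by rewrite comp_polyXr coef_poly leqnn.
Qed.

Lemma fps_compXl f : f 0%N = 0 -> fps_comp (fps_X K) f =1 f.
Proof.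
move=> f0 n.
rewrite (@agree_comp n.+1 _ _ _ _ f0 _ (@agree_X _) (@agree_trunc n.+1 f)) //.
by rewrite comp_polyX coef_poly leqnn.
Qed.

Lemma comp_inverse_unique f g g' : f 0%N = 0 ->
  is_comp_inverse f g -> is_comp_inverse f g' -> g =1 g'.
Proof.
move=> f0 [g0 fg gf] [g'0 fg' g'f] n.
rewrite -[LHS]fps_compX -(fps_comp_ext (frefl g) fg') fps_compA //.
by rewrite (fps_comp_ext gf (frefl g')) fps_compXl.
Qed.

End CompTheory.

Section Existence.
Variable K : fieldType.
Implicit Types (f g h : fps K).

Let left_inverse f : f 0%N = 0 -> f 1%N != 0 ->
  exists g, [/\ g 0%N = 0, g 1%N != 0 & fps_comp g f =1 fps_X K].
Proof.
move=> f0 f1.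
pose next s := ((size s == 1)%:R - \sum_(k < size s) s`_k * fps_pow f k (size s))
               / f 1%N ^+ size s.
pose L n := iter n (fun s => rcons s (next s)) [::].
have sL n : size (L n) = n by elim: n => //= n IHn; rewrite size_rcons IHn.
pose g n := next (L n).
have nthL n k : (k < n)%N -> (L n)`_k = g k.
  elim: n => // n IHn; rewrite ltnS => lekn /=; rewrite nth_rcons sL.
  by case: ltngtP lekn => // [ltkn _|-> //]; apply: IHn.
have compE n : fps_comp g f n = (n == 1)%:R.
  rewrite /fps_comp big_ord_recr /= fps_pow_diag // {2}/g /next sL.
  rewrite divfK ?expf_neq0 // addrC -addrA -[RHS]addr0; congr (_ + _).
  by apply/eqP; rewrite addrC subr_eq0; apply/eqP/eq_bigr => k _; rewrite nthL.
have g0 : g 0%N = 0 by have := compE 0%N; rewrite fps_comp0.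
exists g; split=> //; apply/eqP => g1.
have := compE 1%N; rewrite /fps_comp !big_ord_recl big_ord0 /= g0 g1 !mul0r !addr0.
by move/eqP; rewrite eq_sym oner_eq0.
Qed.

Lemma comp_inverse_exists f : f 0%N = 0 -> f 1%N != 0 ->
  exists g, is_comp_inverse f g.
Proof.
move=> f0 f1; have [g [g0 g1 gf]] := left_inverse f0 f1.
have [h [h0 h1 hg]] := left_inverse g0 g1.
exists g; split=> // n.
have hf : h =1 f.
  move=> k; rewrite -[LHS]fps_compX -(fps_comp_ext (frefl h) gf) fps_compA //.
  by rewrite (fps_comp_ext hg (frefl f)) fps_compXl.
by rewrite -hg; apply: fps_comp_ext => // k; rewrite hf.
Qed.

Lemma triangular_map (E q : nat -> {poly K}) : (forall m, size (E m) = m.+1) ->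
  exists D : {linear {poly K} -> {poly K}}, forall m, D (E m) = q m.
Proof.
move=> sE.
have lE m : (E m)`_m != 0.
  have : lead_coef (E m) != 0 by rewrite lead_coef_eq0 -size_poly_eq0 sE.
  by rewrite lead_coefE sE.
pose c m (p : {poly K}) := p`_m / (E m)`_m.
pose fix T (n : nat) (p : {poly K}) {struct n} : {poly K} :=
  if n is m.+1 then c m p *: q m + T m (p - c m p *: E m) else 0.
have cD m a p p' : c m (a *: p + p') = a * c m p + c m p'.
  by rewrite /c coefD coefZ mulrDl mulrA.
have TD n a p p' : T n (a *: p + p') = a *: T n p + T n p'.
  elim: n p p' => [|n IHn] p p' /=; first by rewrite scaler0 addr0.
  rewrite cD !scalerDl scalerDr scalerA addrACA -IHn; congr (_ + T _ _).
  by rewrite scalerBr scalerA opprD addrACA.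
have T0 n : T n 0 = 0.
  by elim: n => //= n IHn; rewrite /c coef0 mul0r !scale0r subr0 add0r.
have Tstable n (p : {poly K}) k : (size p <= n)%N -> T (k + n)%N p = T n p.
  move=> sp; elim: k => //= k <-.
  by rewrite /c nth_default ?mul0r ?scale0r ?subr0 ?add0r // (leq_trans sp) ?leq_addl.
pose D (p : {poly K}) := T (size p) p.
have DE n (p : {poly K}) : (size p <= n)%N -> D p = T n p.
  by move=> sp; rewrite /D -(subnK sp) Tstable.
have Dlin : linear D.
  move=> a p p'; pose n := maxn (size (a *: p + p')) (maxn (size p) (size p')).
  by rewrite !(DE n) ?TD //; rewrite /n; lia.
pose DM := GRing.isLinear.Build _ _ _ _ D Dlin.
pose DL : {linear {poly K} -> {poly K}} := HB.pack D DM.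
exists DL => m; rewrite [LHS](DE m.+1) ?sE //= /c divff // !scale1r subrr.
by rewrite T0 addr0.
Qed.

Lemma triangular_unique (E : nat -> {poly K}) (D D' : {linear {poly K} -> {poly K}}) :
  (forall m, size (E m) = m.+1) -> (forall m, D (E m) = D' (E m)) -> D =1 D'.
Proof.
move=> sE eqE p; have [n] := ubnP (size p); elim: n p => // n IHn p ltpn.
have [->|p0] := eqVneq p 0; first by rewrite !linear0.
pose m := (size p).-1.
have sp : size p = m.+1 by rewrite /m prednK // size_poly_gt0.
have lE : (E m)`_m != 0.
  have : lead_coef (E m) != 0 by rewrite lead_coef_eq0 -size_poly_eq0 sE.
  by rewrite lead_coefE sE.
pose a := p`_m / (E m)`_m.
suff eqr : D (p - a *: E m) = D' (p - a *: E m).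
  by rewrite -[p](subrK (a *: E m)) linearD [RHS]linearD eqr !linearZ eqE.
apply: IHn; apply: leq_trans (_ : m.+1 <= n)%N.
  rewrite ltnS; apply/leq_sizeP => j lemj; rewrite coefB coefZ.
  case: ltngtP lemj => // [ltmj _|<- _]; last by rewrite divfK ?subrr.
  by rewrite !nth_default ?mulr0 ?subr0 ?sE ?sp.
by rewrite -sp -ltnS.
Qed.

End Existence.

Section Numeric.
Variable K : numFieldType.

Lemma size_exp_xB (B : fps K) m : B 0%N = 0 -> B 1%N != 0 ->
  size (exp_xB B m) = m.+1.
Proof.
move=> B0 B1.
have -> : exp_xB B m = \poly_(n < m.+1) (n`!%:R^-1 * fps_pow B n m).
  by rewrite poly_def.
rewrite size_poly_eq // fps_pow_diag // mulf_neq0 ?expf_neq0 //.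
by rewrite invr_neq0 // pnatr_eq0 -lt0n fact_gt0.
Qed.

Lemma umbral_shift_exists (B : fps K) : B 0%N = 0 -> B 1%N != 0 ->
  exists D, is_umbral_shift B D.
Proof. by move=> B0 B1; apply: triangular_map => m; apply: size_exp_xB. Qed.

Lemma umbral_shift_unique (B : fps K) D D' : B 0%N = 0 -> B 1%N != 0 ->
  is_umbral_shift B D -> is_umbral_shift B D' -> D =1 D'.
Proof.
move=> B0 B1 BD BD'; apply: (@triangular_unique _ (exp_xB B)).
  by move=> m; apply: size_exp_xB.
by move=> m; rewrite BD BD'.
Qed.

End Numeric.

(* Main.v *)
(** With E_m the coefficient of w^m in e^{xB(w)}, <A(v)|E_m> is the coefficient
    of w^m in A(B(w)). Hence <A|D_B E_m> is the coefficient of w^m in the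
    derivative of A(B(w)), which is A'(B(w)) B'(w); since B'(w) = B^*(B(w)),
    this derivative is (B^* A')(B(w)). As the E_m form a basis of K[x], the
    adjunction follows by linearity. *)
From HB Require Import structures.
Require Import Defs.
From mathcomp Require Import all_boot all_order all_algebra.
Import GRing.Theory Num.Theory.
Local Open Scope ring_scope.

Section Truncation.
Variable K : comNzRingType.
Implicit Types (f g h : fps K) (p q : {poly K}).

(** Transfers laws of [{poly K}] to series: each coefficient depends only on finitely many others,
    so an identity can be checked on truncations. *)
Definition eq_below N f p := forall i, (i < N)%N -> f i = p`_i.

Lemma eq_below_poly N f : eq_below N f (\poly_(i < N) f i).
Proof. by move=> i ltiN; rewrite coef_poly ltiN. Qed.

Lemma eq_below_mul N f g p q :
  eq_below N f p -> eq_below N g q -> eq_below N (fps_mul f g) (p * q).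
Proof.
move=> fp gq n ltnN; rewrite coefM; apply: eq_bigr => i _.
by rewrite fp ?gq // (leq_ltn_trans _ ltnN) ?leq_subr // -ltnS.
Qed.

Lemma eq_below_pow N f p k : eq_below N f p -> eq_below N (fps_pow f k) (p ^+ k).
Proof.
move=> fp; elim: k => [|k IHk]; first by move=> i _; rewrite expr0 coef1.
by rewrite exprS; apply: eq_below_mul.
Qed.

Lemma eq_below_deriv N f p :
  eq_below N.+1 f p -> eq_below N (fps_deriv f) p^`().
Proof. by move=> fp i ltiN; rewrite coef_deriv -fp. Qed.

Lemma eq_below_comp N f h p q : h 0%N = 0 ->
  eq_below N f p -> eq_below N h q -> eq_below N (fps_comp f h) (p \Po q).
Proof.
move=> h0 fp hq n ltnN.
(* As ['X] divides [q], the part of [p] of degree above [n] becomes a multiple of ['X^n.+1] under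
   composition and cannot reach degree [n]. *)
have [r qE] : exists r, q = r * 'X.
  have /factor_theorem[r ->] : root q 0.
    by rewrite /root horner_coef0 -hq ?h0 ?(leq_ltn_trans _ ltnN).
  by exists r; rewrite subr0.
rewrite -(poly_take_drop n.+1 p) comp_polyD comp_polyM comp_Xn_poly coefD.
rewrite {3}qE exprMn mulrA coefMXn ltnSn addr0.
rewrite /take_poly poly_def raddf_sum coef_sum; apply: eq_bigr => k _.
rewrite /= comp_polyZ comp_Xn_poly coefZ fp ?(eq_below_pow N h q) //.
by rewrite (leq_ltn_trans _ ltnN) // -ltnS.
Qed.

Lemma fps_mulC f g : fps_mul f g =1 fps_mul g f.
Proof.
move=> n; have A u := eq_below_poly n.+1 u.
rewrite (eq_below_mul _ _ _ _ _ (A f) (A g)) // mulrC.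
by rewrite (eq_below_mul _ _ _ _ _ (A g) (A f)).
Qed.

Lemma fps_comp_mul f g h : h 0%N = 0 ->
  fps_comp (fps_mul f g) h =1 fps_mul (fps_comp f h) (fps_comp g h).
Proof.
move=> h0 n; have A u := eq_below_poly n.+1 u.
rewrite (eq_below_comp _ _ _ _ _ h0 (eq_below_mul _ _ _ _ _ (A f) (A g)) (A h)) //.
rewrite comp_polyM; symmetry.
by apply: (eq_below_mul n.+1) => //; apply: eq_below_comp.
Qed.

Lemma fps_deriv_comp f h : h 0%N = 0 ->
  fps_deriv (fps_comp f h) =1
  fps_mul (fps_comp (fps_deriv f) h) (fps_deriv h).
Proof.
(* Differentiation costs one order of precision, hence [n.+2]; the undifferentiated [h] inside the
   composition is needed only below [n.+1]. *)
move=> h0 n; have A u := eq_below_poly n.+2 u.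
have Ah : eq_below n.+1 h (\poly_(i < n.+2) h i).
  by move=> i ltin; rewrite A // ltnW.
rewrite (eq_below_deriv n.+1 _ _ (eq_below_comp _ _ _ _ _ h0 (A f) (A h))) //.
rewrite deriv_comp; symmetry.
apply: (eq_below_mul n.+1) => //; last exact: eq_below_deriv.
by apply: eq_below_comp => //; apply: eq_below_deriv.
Qed.

Lemma fps_comp_star_mul B Bbar f : B 0%N = 0 -> is_comp_inverse B Bbar ->
  fps_comp (fps_mul (fps_star B Bbar) (fps_deriv f)) B =1
  fps_deriv (fps_comp f B).
Proof.
move=> B0 [Bbar0 _ BbarB] n; rewrite fps_comp_mul // fps_deriv_comp //.
rewrite fps_mulC; apply: eq_bigr => i _; congr (_ * _).
(* Reassociating brings [Bbar] next to [B], where they compose to the identity series. *)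
rewrite /fps_star -fps_compA // -[RHS]fps_compX.
exact: fps_comp_ext.
Qed.

(** Gives polynomials of different sizes a common summation range, as linearity requires. *)
Lemma pairing_widen N f p : (size p <= N)%N ->
  pairing f p = \sum_(n < N) p`_n * egf_coef f n.
Proof.
move=> lepN; rewrite /pairing (big_ord_widen _ (fun n => p`_n * egf_coef f n) lepN).
rewrite big_mkcond; apply: eq_bigr => n _ /=.
by case: ltnP => // lepn; rewrite nth_default ?mul0r.
Qed.

(* Constant polynomials as values, so that triangular_unique applies. *)
Definition pairing_poly f p : {poly K} := (pairing f p)%:P.

Lemma pairing_poly_is_linear f : linear (pairing_poly f).
Proof.
move=> a p q; set N := maxn (size (a *: p + q)) (maxn (size p) (size q)).
rewrite /pairing_poly !(pairing_widen N) ?leq_max ?leqnn ?orbT //.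
rewrite scale_polyC -polyCD mulr_sumr -big_split /=; congr (_%:P).
by apply: eq_bigr => n _; rewrite coefD coefZ mulrDl mulrA.
Qed.

HB.instance Definition _ f := GRing.isLinear.Build K {poly K} {poly K} _
  (pairing_poly f) (pairing_poly_is_linear f).

End Truncation.

Lemma pairing_exp_xB (K : numFieldType) (A B : fps K) m :
  pairing A (exp_xB B m) = fps_comp A B m.
Proof.
have expE : exp_xB B m = \poly_(n < m.+1) (n`!%:R^-1 * fps_pow B n m).
  by rewrite poly_def.
rewrite (pairing_widen _ m.+1) expE ?size_poly //; apply: eq_bigr => n _.
(* The factor [n!] of the pairing cancels the [1/n!] of the exponential. *)
rewrite coef_poly ltn_ord /egf_coef mulrC mulrACA divff ?mul1r //.
by rewrite pnatr_eq0 -lt0n fact_gt0.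
Qed.

Theorem theorem4p5 (R : realType) (B Bbar : fps R[i])
    (D_B : {linear {poly R[i]} -> {poly R[i]}})
    (B_0 : B 0%N = 0) (B_1 : egf_coef B 1 != 0)
    (BbarP : is_comp_inverse B Bbar) (D_BP : is_umbral_shift B D_B) :
  forall (A : fps R[i]) (p : {poly R[i]}),
    pairing (fps_mul (fps_star B Bbar) (fps_deriv A)) p = pairing A (D_B p).
Proof.
move=> A p; apply: polyC_inj; set f := fps_mul _ _.
have B1 : B 1%N != 0 by move: B_1; rewrite /egf_coef mul1r.
apply: (triangular_unique (E := exp_xB B) (D := pairing_poly _ f)
  (D' := pairing_poly _ A \o D_B)) => m; first exact: size_exp_xB.
(* [D_B] sends E_m to (m+1) E_{m+1}; the integer factor leaves the pairing by additivity and becomes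
   the one in the derivative of A(B(w)). *)
rewrite /= D_BP /fps_deriv raddfMn -polyCMn; congr (_%:P).
by rewrite !pairing_exp_xB fps_comp_star_mul.
Qed.
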